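(* Let $t\ge 1$ be an integer, let $\Omega\subseteq\mathbb{Q}^r$, and let $A=\{\mathbf{a}_1,\ldots,\mathbf{a}_n\}$, $B=\{\mathbf{b}_1,\ldots,\mathbf{b}_n\}$ be multisets of points of $\Omega$ such that $(A,B)$ is a proper $\mathrm{PTE}_r$ solution of degree $2t$ and size $n$. Let $\mathbf{t}_1,\ldots,\mathbf{t}_d$ be a basis of $\mathcal{P}_t(\Omega)$, where $d=\dim_{\mathbb{Q}}\mathcal{P}_t(\Omega)$, and define the $d\times n$ matrices $N_A=(\mathbf{t}_i(\mathbf{a}_j))_{i,j}$ and $N_B=(\mathbf{t}_i(\mathbf{b}_j))_{i,j}$. Suppose that the $d\times 2n$ matrix $[N_A\;N_B]$ has rank $d$. Then $n\ge \dim_{\mathbb{Q}}\mathcal{P}_t(\Omega)$.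
   Context: For multisets $A=\{\mathbf{a}_1,\ldots,\mathbf{a}_n\}$, $B=\{\mathbf{b}_1,\ldots,\mathbf{b}_n\}$ of vectors in $\mathbb{Q}^r$, with $\mathbf{a}_i=(a_{i1},\ldots,a_{ir})$, $\mathbf{b}_i=(b_{i1},\ldots,b_{ir})$, one writes $[A]=^n_m[B]$ and calls $(A,B)$ a solution of the $r$-dimensional Prouhet–Tarry–Escott problem $\mathrm{PTE}_r$ of degree $m$ and size $n$ if $A$ and $B$ have no element in common and $\sum_{i=1}^n\prod_{j=1}^r a_{ij}^{k_j}=\sum_{i=1}^n\prod_{j=1}^r b_{ij}^{k_j}$ for all nonnegative integers $k_1,\ldots,k_r$ with $1\le k_1+\cdots+k_r\le m$. Such a solution is called (combinatorially) proper if, regarding $A$ and $B$ as $n\times r$ matrices whose rows are the $\mathbf{a}_i$ resp. $\mathbf{b}_i$, $\operatorname{rank}A=\operatorname{rank}B=r$. For $\Omega\subseteq\mathbb{Q}^r$, $\mathcal{P}_t(\Omega)$ denotes the $\mathbb{Q}$-vector space of functions on $\Omega$ that are restrictions of polynomials in $r$ variables with rational coefficients of degree at most $t$. *)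

(* Defs.v *)
From Stdlib Require Export ClassicalEpsilon.
From HB Require Export structures.
From mathcomp Require Export all_boot all_order all_algebra.
From mathcomp Require Export mpoly.

Set Implicit Arguments.
Unset Strict Implicit.
Unset Printing Implicit Defensive.

Import GRing.Theory.
Local Open Scope ring_scope.

(* A multiset of n vectors of Q^r is given by an n x r matrix of rows; every
   notion below is invariant under permuting the rows. *)
Definition pte_solution (r m n : nat) (A B : 'M[rat]_(n, r)) : Prop :=
  (forall i j : 'I_n, row i A <> row j B) /\
  (forall k : 'I_r -> nat,
     (1 <= \sum_(j < r) k j)%N -> (\sum_(j < r) k j <= m)%N ->
     \sum_(i < n) \prod_(j < r) A i j ^+ k j =
     \sum_(i < n) \prod_(j < r) B i j ^+ k j).

Definition proper_pte_solution (r m n : nat) (A B : 'M[rat]_(n, r)) : Prop :=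
  [/\ pte_solution m A B, \rank A = r & \rank B = r].

Section Points.

Variables (r : nat) (Omega : 'rV[rat]_r -> Prop).

Definition point : Type := {x : 'rV[rat]_r | Omega x}.

Definition points_mx (n : nat) (a : 'I_n -> point) : 'M[rat]_(n, r) :=
  \matrix_(i < n) proj1_sig (a i).

(* [msize p] is the total degree plus one, and 0 for p = 0. *)
Definition poly_fun (t : nat) (f : point -> rat) : Prop :=
  exists2 p : {mpoly rat[r]}, (msize p <= t.+1)%N &
    forall x : point, f x = p.@[fun j => proj1_sig x ord0 j].

End Points.

Section FunctionSpaces.

Variable T : Type.

Definition lin_indep (d : nat) (e : 'I_d -> T -> rat) : Prop :=
  forall c : 'I_d -> rat,
    (forall x, \sum_(i < d) c i * e i x = 0) -> forall i, c i = 0.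

Definition spans (V : (T -> rat) -> Prop) (d : nat) (e : 'I_d -> T -> rat) :
    Prop :=
  forall f, V f ->
    exists c : 'I_d -> rat, forall x, f x = \sum_(i < d) c i * e i x.

Definition is_basis (V : (T -> rat) -> Prop) (d : nat) (e : 'I_d -> T -> rat) :
    Prop :=
  [/\ forall i, V (e i), lin_indep e & spans V e].

(* The number of elements of a finite basis; unspecified if V has none. *)
Definition dimQ (V : (T -> rat) -> Prop) : nat :=
  epsilon (inhabits 0%N)
    (fun d => exists e : 'I_d -> T -> rat, is_basis V e).

Definition eval_mx (d n : nat) (e : 'I_d -> T -> rat) (a : 'I_n -> T) :
    'M[rat]_(d, n) :=
  \matrix_(i < d, j < n) e i (a j).

End FunctionSpaces.

(* Main.v *)
Require Import Defs.
From mathcomp Require Import all_boot all_order all_algebra.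

(** If [f] in [P_t(Omega)] vanishes on [A], then [f ^ 2] has degree at most
    [2 t], so its sum over [B] equals its sum over [A], which is [0]; hence [f]
    vanishes on [B] as well. Thus the left kernel of [N_A] is contained in that
    of [[N_A N_B]], which is trivial, and the [d x n] matrix [N_A] has rank
    [d]. *)

Set Implicit Arguments.
Unset Strict Implicit.
Unset Printing Implicit Defensive.

Import GRing.Theory Num.Theory.

Local Open Scope ring_scope.

(** The coordinates of the [e' i] with respect to [e] form a [d'] by [d] matrix; a row vector in its
    left kernel is a linear relation among the [e' i], so the matrix has rank [d']. *)
Lemma lin_indep_leq_spans (T : Type) (V : (T -> rat) -> Prop) (d d' : nat)
    (e : 'I_d -> T -> rat) (e' : 'I_d' -> T -> rat) :
  spans V e -> (forall i, V (e' i)) -> lin_indep e' -> (d' <= d)%N.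
Proof.
move=> spane Ve' inde'.
have [c e'E] : exists c : 'I_d' -> 'I_d -> rat,
    forall i x, e' i x = \sum_(j < d) c i j * e j x.
  have ex i := constructive_indefinite_description _ (spane _ (Ve' i)).
  by exists (fun i => proj1_sig (ex i)) => i; exact: (proj2_sig (ex i)).
have: row_free (\matrix_(i < d', j < d) c i j).
  apply: inj_row_free => v vc0; apply/rowP => i; rewrite [RHS]mxE.
  apply: (inde' (fun i => v ord0 i)) => x.
  under eq_bigr do rewrite e'E mulr_sumr.
  rewrite exchange_big big1 //= => j _.
  have /rowP/(_ j) := vc0; rewrite !mxE => vcj.
  under eq_bigr do rewrite mulrA.
  rewrite -mulr_suml (eq_bigr (fun k => v 0 k *
    (\matrix_(i < d', j < d) c i j) k j)) ?vcj ?mul0r // => k _.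
  by rewrite mxE.
by move/eqP<-; exact: rank_leq_col.
Qed.

(** Since a basis exists, the number picked by [epsilon] is the size of some basis, and any two
    finite bases have equal size. *)
Lemma dimQ_basis (T : Type) (V : (T -> rat) -> Prop) (d : nat)
    (e : 'I_d -> T -> rat) : is_basis V e -> dimQ V = d.
Proof.
move=> be; have [Ve inde spane] := be.
have [e' [Ve' inde' spane']] := epsilon_spec (inhabits 0%N)
  (fun d => exists e : 'I_d -> T -> rat, is_basis V e)
  (ex_intro _ d (ex_intro _ e be)).
apply/eqP; rewrite eqn_leq (lin_indep_leq_spans spane Ve' inde').
exact: lin_indep_leq_spans spane' Ve inde.
Qed.

Lemma pte_solution_sum_meval (r m n : nat) (A B : 'M[rat]_(n, r))
    (p : {mpoly rat[r]}) : pte_solution m A B -> (msize p <= m.+1)%N ->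
  \sum_(i < n) p.@[A i] = \sum_(i < n) p.@[B i].
Proof.
move=> [_ hAB] szp; under eq_bigr do rewrite mevalE.
under [RHS]eq_bigr do rewrite mevalE.
rewrite exchange_big [RHS]exchange_big /=.
apply: eq_big_seq => k /msize_mdeg_lt kp; rewrite -!mulr_sumr; congr (_ * _).
(* The PTE equations start at degree 1. For the constant monomial both sums consist of [n] ones. *)
have [k0|kpos] := posnP (mdeg k); last first.
  by apply: hAB; rewrite -mdegE // -ltnS (leq_trans kp).
move/eqP: k0; rewrite mdeg_eq0 => /eqP->.
by apply: eq_bigr => i _; rewrite !big1 // => j _; rewrite mnm0E expr0.
Qed.

Lemma msize_sqr_leq (r t : nat) (p : {mpoly rat[r]}) :
  (msize p <= t.+1)%N -> (msize (p ^+ 2) <= (2 * t).+1)%N.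
Proof.
move=> szp; have [->|p0] := eqVneq p 0; first by rewrite expr0n msize0.
rewrite expr2 msizeM // mul2n -addnn -ltnS.
by rewrite prednK ?addn_gt0 ?lt0n ?msize_poly_eq0 ?p0 // -addSn -addnS leq_add.
Qed.

Lemma poly_fun_lincomb (r t d : nat) (Omega : 'rV[rat]_r -> Prop)
    (e : 'I_d -> point Omega -> rat) (c : 'I_d -> rat) :
  (forall i, poly_fun t (e i)) ->
  poly_fun t (fun x => \sum_(i < d) c i * e i x).
Proof.
(* Induction on [d] opens one existential polynomial at a time, so no choice of a family is
   needed. *)
elim: d e c => [|d IHd] e c pe.
  by exists 0 => [|x]; rewrite ?msize0 // big_ord0 meval0.
have [p szp pE] := IHd _ (fun i => c (lift ord0 i)) (fun i => pe (lift ord0 i)).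
have [q szq qE] := pe ord0.
exists (c ord0 *: q + p) => [|x]; last first.
  by rewrite big_ord_recl mevalD mevalZ -qE -pE.
apply: leq_trans (mmeasureD_le _ _ _) _.
by rewrite geq_max szp andbT (leq_trans (msizeZ_le _ _)).
Qed.

Lemma poly_fun_pte_eq0 (r n t : nat) (Omega : 'rV[rat]_r -> Prop)
    (a b : 'I_n -> point Omega) (f : point Omega -> rat) :
  pte_solution (2 * t) (points_mx a) (points_mx b) -> poly_fun t f ->
  (forall i, f (a i) = 0) -> forall i, f (b i) = 0.
Proof.
move=> hAB [p szp fE] fa0 i.
have evalE (c : 'I_n -> point Omega) j :
    (p ^+ 2).@[points_mx c j] = f (c j) ^+ 2.
  by rewrite fE -rmorphXn /=; apply: meval_eq => k; rewrite mxE.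
have := pte_solution_sum_meval hAB (msize_sqr_leq szp).
under eq_bigr do rewrite evalE fa0 expr0n.
under [RHS]eq_bigr do rewrite evalE.
(* A vanishing sum of rational squares has only zero terms. *)
rewrite big1 // => /esym/psumr_eq0P sum0; apply/eqP; rewrite -sqrf_eq0.
by apply/eqP/sum0 => // j _; exact: sqr_ge0.
Qed.

Theorem theorem2p12 (r n t : nat) (ht : (1 <= t)%N)
  (Omega : 'rV[rat]_r -> Prop)
  (a b : 'I_n -> point Omega)
  (hAB : proper_pte_solution (2 * t) (points_mx a) (points_mx b))
  (d : nat) (e : 'I_d -> point Omega -> rat)
  (he : is_basis (@poly_fun r Omega t) e)
  (hrank : \rank (row_mx (eval_mx e a) (eval_mx e b)) = d) :
  (dimQ (@poly_fun r Omega t) <= n)%N.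
Proof.
rewrite (dimQ_basis he); have [pe _ _] := he; have [pte _ _] := hAB.
have freeAB : row_free (row_mx (eval_mx e a) (eval_mx e b)) by apply/eqP.
suff /eqP <- : row_free (eval_mx e a) by exact: rank_leq_col.
apply: inj_row_free => v va0.
(* The vector [v] is read as the function with coordinates [v], whose values at the points are the
   entries of [v *m eval_mx e _]. *)
pose f x := \sum_(i < d) v ord0 i * e i x.
have mulE (c : 'I_n -> point Omega) j :
    (v *m eval_mx e c) ord0 j = f (c j).
  by rewrite mxE; apply: eq_bigr => i _; rewrite mxE.
have fa0 j : f (a j) = 0 by rewrite -mulE va0 mxE.
have fb0 j : f (b j) = 0.
  exact: poly_fun_pte_eq0 pte (poly_fun_lincomb _ pe) fa0 j.
apply/eqP; rewrite -(mulmx_free_eq0 v freeAB) mul_mx_row va0.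
suff -> : v *m eval_mx e b = 0 by rewrite row_mx0.
by apply/rowP => j; rewrite mulE fb0 mxE.
Qed.
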